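(* For every finite tree $T$, the first Betti number of $\operatorname{Aut}^\star(A_T)$ satisfies $$b_1(\operatorname{Aut}^\star(A_T)) \ge \Upsilon(T),\qquad \text{where}\quad \Upsilon(T)=\sum_{v\in D(T)}\ \sum_{w\in \operatorname{lk}(v)}(\deg(w)-1).$$
   Context: Trees are finite connected graphs without cycles; $V(T)$, $E(T)$ are the sets of nodes and edges. The link $\operatorname{lk}(v)$ is the set of neighbors of $v$, $\operatorname{st}(v)=\operatorname{lk}(v)\cup\{v\}$, and $\deg(v)=|\operatorname{lk}(v)|$. $T\setminus \operatorname{st}(v)$ is the full subgraph induced by the vertices not in $\operatorname{st}(v)$. A leaf is a node of degree $1$; $\partial T$ is the set of leaves; $d$ is the combinatorial (path) distance; a node $v$ is deep if $d(v,\partial T)\ge 3$; $D(T)$ is the set of deep nodes. The right-angled Artin group $A_T$ has generating set $V(T)$ and defining relations $[a,b]=1$ for every edge $ab\in E(T)$. Write $v\le w$ if $\operatorname{lk}(v)\subset \operatorname{st}(w)$, and $v\sim w$ if $v\le w$ and $w\le v$ (an equivalence relation). A node is thin if its $\sim$-class has exactly one element. $\operatorname{Aut}^\star(A_T)$ is the (finite-index) subgroup of $\operatorname{Aut}(A_T)$ generated by the following automorphisms. - Transvections $t_{uv}$, for $u\neq v$ with $u\le v$: $t_{uv}$ sends $u$ to $uv$ and fixes all other generators. - Partial conjugations $c_{Y,u}$, for $u\in V(T)$ and $Y$ a connected component of $T\setminus\operatorname{st}(u)$: $c_{Y,u}(v)=u^{-1}vu$ if $v\in Y$ and $c_{Y,u}(v)=v$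 for the generators $v\notin Y$. - Thin inversions: for a node $v$ that is not thin, the automorphism sending $v$ to $v^{-1}$ and fixing all other generators (so every thin node is fixed). The first Betti number $b_1(G)$ of a finitely generated group $G$ is the rank of the abelian group $G/[G,G]=H_1(G,\mathbb{Z})$. *)

(* Defs.v *)
From HB Require Import structures.
From mathcomp Require Import all_boot all_algebra.
From mathcomp Require Import boolp classical_sets.

Set Implicit Arguments.
Unset Strict Implicit.
Unset Printing Implicit Defensive.

Section GeneratedSubgroup.
Local Open Scope group_scope.
Variable G : groupType.

Inductive generated (S : G -> Prop) : G -> Prop :=
| Gen_in x : S x -> generated S x
| Gen_1 : generated S 1
| Gen_mul x y : generated S x -> generated S y -> generated S (x * y)
| Gen_inv x : generated S x -> generated S x^-1.

Definition generatedb (S : G -> Prop) : pred G := fun x => `[< generated S x >].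

Lemma generatedb_closed (S : G -> Prop) : group_closed (generatedb S).
Proof.
split=> [|x y]; first exact/asboolP/Gen_1.
by move=> /asboolP Sx /asboolP Sy; apply/asboolP/Gen_mul => //; apply: Gen_inv.
Qed.

Definition derived : G -> Prop :=
  generated (fun z => exists x y : G, z = [~ x, y]).

End GeneratedSubgroup.

Definition gen_group (G : groupType) (S : G -> Prop) : Type :=
  {x : G | generatedb S x}.
HB.instance Definition _ (G : groupType) (S : G -> Prop) :=
  SubChoice.on (gen_group S).
HB.instance Definition _ (G : groupType) (S : G -> Prop) :=
  SubChoice_isSubGroup.Build G (generatedb S) (gen_group S)
    (generatedb_closed S).

Section Automorphisms.
Local Open Scope group_scope.
Variable G : groupType.

Definition is_aut : pred (G -> G) :=
  fun f => `[< {morph f : x y / x * y} /\ bijective f >].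

Record Aut : Type := MkAut { aut_fun :> G -> G; aut_funP : is_aut aut_fun }.

HB.instance Definition _ := [isSub for aut_fun].
HB.instance Definition _ := [Choice of Aut by <:].

Lemma autM (f : Aut) : {morph f : x y / x * y}.
Proof. by case: f => f /= /asboolP []. Qed.

Lemma aut_bij (f : Aut) : bijective f.
Proof. by case: f => f /= /asboolP []. Qed.

Lemma aut_ext (f g : Aut) : f =1 g -> f = g.
Proof. by move=> fg; apply/val_inj/funext. Qed.

Fact aut_one_subproof : is_aut id.
Proof. by apply/asboolP; split=> //; exists id. Qed.

Definition aut_one : Aut := MkAut aut_one_subproof.

Fact aut_mul_subproof (f g : Aut) : is_aut (f \o g).
Proof.
apply/asboolP; split; first by move=> x y /=; rewrite !autM.
exact: bij_comp (aut_bij f) (aut_bij g).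
Qed.

(* The product [f * g] of automorphisms applies [g] first. *)
Definition aut_mul (f g : Aut) : Aut := MkAut (aut_mul_subproof f g).

Fact aut_inv_ex (f : Aut) : exists g, cancel f g /\ cancel g f.
Proof. by case: (aut_bij f) => g fK gK; exists g. Qed.

Definition aut_inv_fun (f : Aut) : G -> G := sval (cid (aut_inv_ex f)).

Lemma aut_inv_funK (f : Aut) : cancel f (aut_inv_fun f).
Proof. exact: (svalP (cid (aut_inv_ex f))).1. Qed.

Lemma aut_funK (f : Aut) : cancel (aut_inv_fun f) f.
Proof. exact: (svalP (cid (aut_inv_ex f))).2. Qed.

Fact aut_inv_subproof (f : Aut) : is_aut (aut_inv_fun f).
Proof.
apply/asboolP; split; last by exists f; [exact: aut_funK|exact: aut_inv_funK].
move=> x y; apply: (can_inj (aut_inv_funK f)).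
by rewrite autM !aut_funK.
Qed.

Definition aut_inv (f : Aut) : Aut := MkAut (aut_inv_subproof f).

Fact aut_mulA : associative aut_mul. Proof. by move=> f g h; apply: aut_ext. Qed.
Fact aut_mul1 : left_id aut_one aut_mul. Proof. by move=> f; apply: aut_ext. Qed.
Fact aut_mulr1 : right_id aut_one aut_mul.
Proof. by move=> f; apply: aut_ext. Qed.
Fact aut_mulV : left_inverse aut_one aut_inv aut_mul.
Proof. by move=> f; apply: aut_ext; exact: aut_inv_funK. Qed.
Fact aut_mulrV : right_inverse aut_one aut_inv aut_mul.
Proof. by move=> f; apply: aut_ext; exact: aut_funK. Qed.

HB.instance Definition _ :=
  isGroup.Build Aut aut_mulA aut_mul1 aut_mulr1 aut_mulV aut_mulrV.

End Automorphisms.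

Section Abelianization.
Local Open Scope group_scope.
Local Open Scope quotient_scope.
Variable G : groupType.

Definition ab_rel : rel G := fun x y => `[< derived (x^-1 * y) >].

Lemma derived_conj (x y : G) : derived x -> derived (x ^ y).
Proof.
move=> Dx; have -> : x ^ y = x * [~ x, y] by rewrite /commg mulVKg.
by apply: Gen_mul => //; apply: Gen_in; exists x, y.
Qed.

Fact ab_rel_refl : reflexive ab_rel.
Proof. by move=> x; apply/asboolP; rewrite mulVg; apply: Gen_1. Qed.

Fact ab_rel_sym : symmetric ab_rel.
Proof.
suff h x y : ab_rel x y -> ab_rel y x by move=> x y; apply/idP/idP; exact: h.
by move=> /asboolP /Gen_inv; rewrite invgM invgK => ?; apply/asboolP.
Qed.

Fact ab_rel_trans : transitive ab_rel.
Proof.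
move=> y x z /asboolP Dxy /asboolP Dyz; apply/asboolP.
by have := Gen_mul Dxy Dyz; rewrite mulgA mulgK.
Qed.

Canonical ab_equiv := EquivRel ab_rel ab_rel_refl ab_rel_sym ab_rel_trans.

Definition abelianization := {eq_quot ab_equiv}.
HB.instance Definition _ := Choice.on abelianization.
HB.instance Definition _ := EqQuotient.on abelianization.

Definition to_ab (x : G) : abelianization := \pi_abelianization x.

Lemma to_abP (x y : G) : to_ab x = to_ab y <-> derived (x^-1 * y).
Proof.
split; first by move=> /eqquotP /asboolP.
by move=> Dxy; apply/eqquotP/asboolP.
Qed.

Lemma to_ab_repr (a : abelianization) : to_ab (repr a) = a.
Proof. exact: reprK. Qed.

Definition ab_add (a b : abelianization) := to_ab (repr a * repr b).
Definition ab_opp (a : abelianization) := to_ab (repr a)^-1.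
Definition ab_zero := to_ab 1.

Lemma to_abM (x y : G) : to_ab (x * y) = ab_add (to_ab x) (to_ab y).
Proof.
apply/to_abP; set x' := repr _; set y' := repr _.
have /to_abP Dx : to_ab x = to_ab x' by rewrite /x' to_ab_repr.
have /to_abP Dy : to_ab y = to_ab y' by rewrite /y' to_ab_repr.
have -> : (x * y)^-1 * (x' * y') = (x^-1 * x') ^ y * (y^-1 * y').
  by rewrite /conjg invgM !mulgA mulgK.
by apply: Gen_mul => //; apply: derived_conj.
Qed.

Lemma to_abV (x : G) : to_ab x^-1 = ab_opp (to_ab x).
Proof.
apply/to_abP; set x' := repr _.
have /to_abP Dx : to_ab x' = to_ab x by rewrite /x' to_ab_repr.
rewrite invgK; have -> : x * x'^-1 = (x'^-1 * x) ^ x'^-1.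
  by rewrite /conjg invgK !mulgA mulgV mul1g.
exact: derived_conj.
Qed.

Fact ab_addA : associative ab_add.
Proof.
move=> a b c; rewrite -(to_ab_repr a) -(to_ab_repr b) -(to_ab_repr c).
by rewrite -!to_abM mulgA.
Qed.

Fact ab_addC : commutative ab_add.
Proof.
move=> a b; apply/to_abP; apply: Gen_in; exists (repr b), (repr a).
by rewrite /commg /conjg invgM !mulgA.
Qed.

Fact ab_add0 : left_id ab_zero ab_add.
Proof. by move=> a; rewrite -(to_ab_repr a) -to_abM mul1g. Qed.

Fact ab_addN : left_inverse ab_zero ab_opp ab_add.
Proof. by move=> a; rewrite -(to_ab_repr a) -to_abV -to_abM mulVg. Qed.

HB.instance Definition _ :=
  GRing.isZmodule.Build abelianization ab_addA ab_addC ab_add0 ab_addN.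

End Abelianization.

Section Rank.
Local Open Scope ring_scope.
Local Open Scope classical_set_scope.

Definition zfree (A : zmodType) (n : nat) (a : 'I_n -> A) : Prop :=
  forall c : 'I_n -> int, \sum_i a i *~ c i = 0 -> forall i, c i = 0.

Definition is_zrank (A : zmodType) (r : nat) : Prop :=
  (exists a : 'I_r -> A, zfree a) /\
  (forall n (a : 'I_n -> A), zfree a -> (n <= r)%N).

(* The rank is 0 by convention when there are independent families of
   unbounded size; this cannot happen when [A] is finitely generated. *)
Definition zrank (A : zmodType) : nat := xget 0%N [set r | is_zrank A r].

Lemma zrankE (A : zmodType) (r : nat) : is_zrank A r -> zrank A = r.
Proof.
move=> rk; apply: xget_unique => // s [[a fa] ub]; apply/eqP.
by rewrite eqn_leq; case: rk => -[b fb] ub'; rewrite (ub' _ _ fa) (ub _ _ fb).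
Qed.

Definition b1 (G : groupType) : nat := zrank (abelianization G).

End Rank.

Section Graph.
Local Open Scope nat_scope.
Variables (V : finType) (e : rel V).

Record is_tree : Prop := IsTree {
  tree_nonempty : 0 < #|V|;
  tree_sym : symmetric e;
  tree_irr : irreflexive e;
  tree_connected : forall x y : V, connect e x y;
  (* The empty sequence and the traversal [:: x; y] of an edge back and forth
     satisfy [ucycle e], but are not cycles of the graph. *)
  tree_acyclic : forall c : seq V, ucycle e c -> size c < 3
}.

Definition lk (v : V) : {set V} := [set w | e v w].
Definition st (v : V) : {set V} := v |: lk v.
Definition deg (v : V) : nat := #|lk v|.
Definition leaf (v : V) : bool := deg v == 1.

Definition walk_of_length (x y : V) (n : nat) : bool :=
  [exists p : n.-tuple V, path e x p && (last x p == y)].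

(* The least length of a walk from [x] to [y] (always [< #|V|] when there is
   one, and [#|V|] when there is none). *)
Definition dist (x y : V) : nat :=
  find (walk_of_length x y) (iota 0 #|V|).

Definition deep (v : V) : bool := [forall l, leaf l ==> (3 <= dist v l)].

(* The subtraction does not truncate: [w] has at least the neighbor [v]. *)
Definition Upsilon : nat := \sum_(v | deep v) \sum_(w in lk v) (deg w - 1).

Definition dom_le (v w : V) : bool := lk v \subset st w.
Definition dom_eq (v w : V) : bool := dom_le v w && dom_le w v.
Definition thin (v : V) : bool := #|[set w | dom_eq v w]| == 1.

Definition off_star (u : V) : rel V :=
  fun x y => [&& x \notin st u, y \notin st u & e x y].

Definition component_off_star (u : V) (Y : {set V}) : Prop :=
  exists2 x, x \notin st u & Y = [set y | connect (off_star u) x y].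

End Graph.

Section RAAG.
Local Open Scope group_scope.
Local Open Scope quotient_scope.
Variables (V : finType) (e : rel V).

(* The letter [(v, true)] stands for [v], and [(v, false)] for its inverse. *)
Definition word : Type := seq (V * bool).

(* The congruence on words whose quotient monoid is the group presented by
   the generators [V] and the relations [a b = b a] for [e a b]. *)
Inductive raag_eq : word -> word -> Prop :=
| Raag_refl w : raag_eq w w
| Raag_sym w w' : raag_eq w w' -> raag_eq w' w
| Raag_trans w w' w'' : raag_eq w w' -> raag_eq w' w'' -> raag_eq w w''
| Raag_cat w1 w1' w2 w2' :
    raag_eq w1 w1' -> raag_eq w2 w2' -> raag_eq (w1 ++ w2) (w1' ++ w2')
| Raag_cancel v b : raag_eq [:: (v, b); (v, ~~ b)] [::]
| Raag_comm a b : e a b ->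
    raag_eq [:: (a, true); (b, true)] [:: (b, true); (a, true)].

Definition raag_rel : rel word := fun w w' => `[< raag_eq w w' >].

Fact raag_rel_refl : reflexive raag_rel.
Proof. by move=> w; apply/asboolP/Raag_refl. Qed.
Fact raag_rel_sym : symmetric raag_rel.
Proof. by move=> w w'; apply/asboolP/asboolP; apply: Raag_sym. Qed.
Fact raag_rel_trans : transitive raag_rel.
Proof.
by move=> w' w w'' /asboolP h /asboolP h'; apply/asboolP/(Raag_trans h h').
Qed.

Canonical raag_equiv :=
  EquivRel raag_rel raag_rel_refl raag_rel_sym raag_rel_trans.

Definition raag := {eq_quot raag_equiv}.
HB.instance Definition _ := Choice.on raag.
HB.instance Definition _ := EqQuotient.on raag.

Definition raag_of (w : word) : raag := \pi_raag w.

Lemma raag_ofP (w w' : word) : raag_of w = raag_of w' <-> raag_eq w w'.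
Proof.
split; first by move=> /eqquotP /asboolP.
by move=> ww'; apply/eqquotP/asboolP.
Qed.

Lemma raag_of_repr (x : raag) : raag_of (repr x) = x.
Proof. exact: reprK. Qed.

Definition inv_word (w : word) : word := rev [seq (l.1, ~~ l.2) | l <- w].

Lemma inv_word_cat (w w' : word) :
  inv_word (w ++ w') = inv_word w' ++ inv_word w.
Proof. by rewrite /inv_word map_cat rev_cat. Qed.

Lemma raag_eq_invr (w : word) : raag_eq (w ++ inv_word w) [::].
Proof.
elim: w => [|[v b] w IH]; first exact: Raag_refl.
rewrite -cat1s inv_word_cat -catA (catA w).
apply: (Raag_trans (w' := [:: (v, b)] ++ [::] ++ inv_word [:: (v, b)])).
  by do 2?apply: Raag_cat => //; apply: Raag_refl.
exact: Raag_cancel.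
Qed.

Lemma inv_wordK : involutive inv_word.
Proof.
move=> w; rewrite /inv_word map_rev revK -map_comp -[RHS]map_id.
by apply: eq_map => -[v b] /=; rewrite negbK.
Qed.

Lemma raag_eq_invl (w : word) : raag_eq (inv_word w ++ w) [::].
Proof. by rewrite -{2}[w]inv_wordK; exact: raag_eq_invr. Qed.

Definition raag_mul (x y : raag) : raag := raag_of (repr x ++ repr y).
Definition raag_inv (x : raag) : raag := raag_of (inv_word (repr x)).
Definition raag_one : raag := raag_of [::].

Lemma raag_of_cat (w w' : word) :
  raag_of (w ++ w') = raag_mul (raag_of w) (raag_of w').
Proof. by apply/raag_ofP/Raag_cat; apply/raag_ofP; rewrite raag_of_repr. Qed.

Fact raag_mulA : associative raag_mul.
Proof.
move=> x y z; rewrite -(raag_of_repr x) -(raag_of_repr y) -(raag_of_repr z).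
by rewrite -!raag_of_cat catA.
Qed.

Fact raag_mul1 : left_id raag_one raag_mul.
Proof. by move=> x; rewrite -(raag_of_repr x) -raag_of_cat. Qed.

Fact raag_mulr1 : right_id raag_one raag_mul.
Proof. by move=> x; rewrite -(raag_of_repr x) -raag_of_cat cats0. Qed.

Fact raag_mulV : left_inverse raag_one raag_inv raag_mul.
Proof.
move=> x; rewrite -{2}(raag_of_repr x) -raag_of_cat.
exact/raag_ofP/raag_eq_invl.
Qed.

Fact raag_mulrV : right_inverse raag_one raag_inv raag_mul.
Proof.
move=> x; rewrite -{1}(raag_of_repr x) -raag_of_cat.
exact/raag_ofP/raag_eq_invr.
Qed.

HB.instance Definition _ :=
  isGroup.Build raag raag_mulA raag_mul1 raag_mulr1 raag_mulV raag_mulrV.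

Definition gen (v : V) : raag := raag_of [:: (v, true)].

(* An automorphism is determined by its values on the generators [gen v], so
   each predicate below singles out exactly the automorphisms with the given
   values. *)

Definition is_transvection (f : Aut raag) : Prop :=
  exists u v : V, [/\ u != v, dom_le e u v,
    f (gen u) = gen u * gen v &
    forall w, w != u -> f (gen w) = gen w].

Definition is_partial_conjugation (f : Aut raag) : Prop :=
  exists (u : V) (Y : {set V}), [/\ component_off_star e u Y,
    forall v, v \in Y -> f (gen v) = (gen u)^-1 * gen v * gen u &
    forall v, v \notin Y -> f (gen v) = gen v].

(* Despite the name, the inverted generators are the ones that are not thin. *)
Definition is_thin_inversion (f : Aut raag) : Prop :=
  exists v : V, [/\ ~~ thin e v,
    f (gen v) = (gen v)^-1 &
    forall w, w != v -> f (gen w) = gen w].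

Definition AutStar : groupType := gen_group (fun f : Aut raag =>
  [\/ is_transvection f, is_partial_conjugation f | is_thin_inversion f]).

End RAAG.

(* Main.v *)
Require Import Defs.
From HB Require Import structures.
From mathcomp Require Import all_boot all_algebra ring.
From mathcomp Require Import boolp.

(** Let [v] be deep and let [x] lie at distance 2 from [v]. Only a generator
    dominating a leaf is the multiplier of a transvection, so [v] is none and
    every [f] in [AutStar] preserves the exponent sum of [v]; moreover [f] sends
    [x] to a conjugate [g x g^-1], as [x] is neither a leaf nor inverted. Hence
    the exponent of [v] in [g], well defined as [x] and [v] do not commute, is
    additive in [f]. On the partial conjugations by deep nodes, which are
    indexed by such pairs [(v, x)] since [x] is the unique node of its component
    at distance 2 from [v], these homomorphisms to Z are dual to the generators.
    To avoid centralizers in the RAAG, the exponent is read off the image of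
    [g x g^-1] in the Heisenberg group, where [x] and [v] become the standard
    generators and all other nodes die. *)

Set Implicit Arguments.
Unset Strict Implicit.
Unset Printing Implicit Defensive.

Import GRing.Theory.

(** * The integral Heisenberg group *)

(* The triple [(a, b, c)] stands for [[1,a,c],[0,1,b],[0,0,1]]. *)
Definition heis : Type := (int * int * int)%type.

Section Heisenberg.
Local Open Scope ring_scope.

Definition heis_mul (g h : heis) : heis :=
  (g.1.1 + h.1.1, g.1.2 + h.1.2, g.2 + h.2 + g.1.1 * h.1.2).
Definition heis_one : heis := (0, 0, 0).
Definition heis_inv (g : heis) : heis :=
  (- g.1.1, - g.1.2, - g.2 + g.1.1 * g.1.2).

Fact heis_mulA : associative heis_mul.
Proof.
by move=> [[a b] c] [[a' b'] c'] [[a'' b''] c'']; congr (_, _, _) => /=; ring.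
Qed.
Fact heis_mul1 : left_id heis_one heis_mul.
Proof. by move=> [[a b] c]; congr (_, _, _) => /=; ring. Qed.
Fact heis_mulr1 : right_id heis_one heis_mul.
Proof. by move=> [[a b] c]; congr (_, _, _) => /=; ring. Qed.
Fact heis_mulV : left_inverse heis_one heis_inv heis_mul.
Proof. by move=> [[a b] c]; congr (_, _, _) => /=; ring. Qed.
Fact heis_mulrV : right_inverse heis_one heis_inv heis_mul.
Proof. by move=> [[a b] c]; congr (_, _, _) => /=; ring. Qed.

HB.instance Definition _ := Choice.on heis.
HB.instance Definition _ :=
  isGroup.Build heis heis_mulA heis_mul1 heis_mulr1 heis_mulV heis_mulrV.

Definition heis_x : heis := (1, 0, 0).
Definition heis_y : heis := (0, 1, 0).

(** Up to sign, the central coordinate of a conjugate of [heis_x] is the [heis_y]-exponent of the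
    conjugator. Hence this exponent depends on the conjugate only, not on the choice of [g]. *)
Lemma heis_conj_x (g : heis) : (g * heis_x * g^-1)%g = (1, 0, - g.1.2).
Proof.
by case: g => [[a b] c]; congr (_, _, _) => /=; ring.
Qed.

End Heisenberg.

(** * Homomorphisms of groups and their factorization through the abelianization *)

Section Groups.
Local Open Scope group_scope.

Section Morphism.
Variables (G H : groupType) (f : G -> H).
Hypothesis fM : {morph f : x y / x * y}.

Lemma morph_one : f 1 = 1.
Proof. by apply: (@mulgI _ (f 1)); rewrite -fM !mulg1. Qed.

Lemma morph_inv (x : G) : f x^-1 = (f x)^-1.
Proof. by apply: (@mulgI _ (f x)); rewrite -fM !mulgV morph_one. Qed.

End Morphism.

Lemma generated_morph_eq (G H : groupType) (S : G -> Prop) (f g : G -> H) :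
  {morph f : x y / x * y} -> {morph g : x y / x * y} ->
  (forall x, S x -> f x = g x) -> forall x, generated S x -> f x = g x.
Proof.
move=> fM gM fg x; elim=> {x} [//||x y _ fx _ fy|x _ fx].
- by rewrite !morph_one.
- by rewrite fM gM fx fy.
- by rewrite !morph_inv // fx.
Qed.

Lemma to_ab_lift (G : groupType) (f : G -> int) :
  (forall x y, f (x * y) = (f x + f y)%R) ->
  {h : {additive abelianization G -> int} | forall x, h (to_ab x) = f x}.
Proof.
move=> fM.
have f1 : f 1 = 0%R by apply: (@addrI _ (f 1)); rewrite -fM mulg1 addr0.
have fV x : f x^-1 = (- f x)%R.
  by apply: (@addrI _ (f x)); rewrite -fM mulgV f1 subrr.
have fD x : derived x -> f x = 0%R.
  elim=> {x} [_ [x [y ->]]||x y _ fx _ fy|x _ fx] //.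
  - by rewrite /commg /conjg !fM !fV; ring.
  - by rewrite fM fx fy.
  - by rewrite fV fx oppr0.
have fE x y : to_ab x = to_ab y -> f x = f y.
  by move/to_abP/fD; rewrite fM fV addrC => /eqP; rewrite subr_eq0 => /eqP.
pose h (a : abelianization G) := f (repr a).
have hE x : h (to_ab x) = f x by apply: fE; rewrite to_ab_repr.
have hD : {morph h : a b / (a + b)%R}.
  move=> a b; rewrite -(to_ab_repr a) -(to_ab_repr b).
  by rewrite -[(_ + _)%R]to_abM !hE fM.
have hN : zmod_morphism h.
  by move=> a b; apply: (@addIr _ (h b)); rewrite -hD !subrK.
pose H := GRing.isZmodMorphism.Build _ _ h hN.
pose hA : {additive abelianization G -> int} := HB.pack h H.
by exists hA.
Qed.

End Groups.

(** * The universal property of a right-angled Artin group and the existence of partial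
    conjugations *)

Section RaagMorphisms.
Local Open Scope group_scope.
Variables (V : finType) (e : rel V).

Lemma gen_inv (v : V) : (gen e v)^-1 = raag_of e [:: (v, false)].
Proof.
apply: (@mulgI _ (gen e v)); rewrite mulgV.
rewrite [RHS](esym (raag_of_cat e [:: (v, true)] [:: (v, false)])).
by apply/raag_ofP/Raag_sym/Raag_cancel.
Qed.

Lemma raag_generated (x : raag e) :
  generated (fun y => exists v, y = gen e v) x.
Proof.
rewrite -(raag_of_repr x); elim: (repr x) => [|[v b] w IH]; first exact: Gen_1.
rewrite -cat1s raag_of_cat; apply: Gen_mul => //.
have gv : generated (fun y => exists v, y = gen e v) (gen e v).
  by apply: Gen_in; exists v.
by case: b => //; rewrite -gen_inv; apply: Gen_inv.
Qed.

Lemma raag_morph_eq (H : groupType) (f g : raag e -> H) :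
  {morph f : x y / x * y} -> {morph g : x y / x * y} ->
  (forall v, f (gen e v) = g (gen e v)) -> f =1 g.
Proof.
move=> fM gM fg x; apply: generated_morph_eq (raag_generated x) => //.
by move=> _ [v ->].
Qed.

Section Lift.
Variables (H : groupType) (phi : V -> H).

Definition word_val (w : word V) : H :=
  \prod_(l <- w) (if l.2 then phi l.1 else (phi l.1)^-1).

Definition raag_lift (x : raag e) : H := word_val (repr x).

Hypothesis phiC : forall a b, e a b -> commute (phi a) (phi b).

Lemma word_val_eq (w w' : word V) : raag_eq e w w' -> word_val w = word_val w'.
Proof.
elim=> {w w'} [//|w w' _ ->//|w w' w'' _ -> //|||].
- move=> w1 w1' w2 w2' _ IH1 _ IH2; rewrite /word_val !big_cat /=.
  by rewrite -!/(word_val _) IH1 IH2.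
- by move=> v [] /=; rewrite /word_val !big_cons big_nil /= mulg1 ?mulgV ?mulVg.
- by move=> a b /phiC; rewrite /word_val !big_cons big_nil /= !mulg1.
Qed.

Lemma raag_lift_word (w : word V) : raag_lift (raag_of e w) = word_val w.
Proof. by apply/word_val_eq/raag_ofP; rewrite raag_of_repr. Qed.

Lemma raag_liftM : {morph raag_lift : x y / x * y}.
Proof.
move=> x y; rewrite -(raag_of_repr x) -(raag_of_repr y).
rewrite -[_ * _]raag_of_cat !raag_lift_word.
by rewrite /word_val big_cat.
Qed.

Lemma raag_lift_gen (v : V) : raag_lift (gen e v) = phi v.
Proof. by rewrite raag_lift_word /word_val big_seq1. Qed.

End Lift.

Lemma aut_eq_gen (f g : Aut (raag e)) :
  (forall v, f (gen e v) = g (gen e v)) -> f = g.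
Proof. by move=> fg; apply/aut_ext/raag_morph_eq => //; apply: autM. Qed.

Section PartialConjugation.
Variables (u : V) (Y : {set V}).
Hypothesis e_sym : symmetric e.
Hypothesis compY : component_off_star e u Y.

Lemma component_off_star_notin (y : V) : y \in Y -> y \notin st e u.
Proof.
case: compY => x xu ->; rewrite inE => /connectP [p pth ->].
elim/last_ind: p pth => [//|p z _]; rewrite rcons_path last_rcons.
by case/andP => _ /and3P [].
Qed.

(** If [b] were outside the star of [u], it would belong to the component of [a]. It is not [u]
    itself, because [a] is not adjacent to [u]. *)
Lemma component_off_star_edge (a b : V) :
  e a b -> a \in Y -> b \notin Y -> b \in lk e u.
Proof.
move=> eab aY bY; have au := component_off_star_notin aY.
have : b \in st e u.
  apply: contraNT bY => bu; case: compY aY => x xu ->.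
  rewrite !inE => xa; apply: connect_trans xa (connect1 _).
  by apply/and3P.
rewrite in_setU1 => /predU1P [bu|//].
by move: au; rewrite in_setU1 inE -bu e_sym eab orbT.
Qed.

(** The conjugator is a parameter because it is taken to be [gen e u] for the partial conjugation
    and the inverse of [gen e u] for its inverse map. *)
Definition pconj_val (z : raag e) (v : V) : raag e :=
  if v \in Y then z^-1 * gen e v * z else gen e v.

Lemma gen_commute (a b : V) : e a b -> commute (gen e a) (gen e b).
Proof.
move=> eab; rewrite /commute -[LHS]raag_of_cat -[RHS]raag_of_cat.
exact/raag_ofP/Raag_comm.
Qed.

(** The critical edges are those leaving [Y]: their outer endpoint is adjacent to [u], hence
    commutes with [z]. *)
Lemma pconj_valC (z : raag e) :
  (forall b, b \in lk e u -> commute z (gen e b)) ->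
  forall a b, e a b -> commute (pconj_val z a) (pconj_val z b).
Proof.
move=> zC; suff h a b : e a b -> a \in Y -> b \notin Y ->
    commute (pconj_val z a) (pconj_val z b).
  move=> a b eab; case aY: (a \in Y); case bY: (b \in Y).
  - rewrite /pconj_val aY bY /commute -[_^-1 * _ * _]mulgA.
    rewrite -[z^-1 * gen e b * z]mulgA -!conjgE -!conjMg.
    by rewrite gen_commute.
  - by apply: h; rewrite ?bY.
  - by apply/commute_sym/h; rewrite ?aY // e_sym.
  - by rewrite /pconj_val aY bY; apply: gen_commute.
move=> eab aY bY; rewrite /pconj_val aY (negbTE bY).
have zb := commute_sym (zC _ (component_off_star_edge eab aY bY)).
apply/commute_sym; apply: commuteM => //; apply: commuteM.
  exact: commuteV.
exact/commute_sym/gen_commute.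
Qed.

Lemma pconj_exists : exists f : Aut (raag e),
  (forall v, v \in Y -> f (gen e v) = (gen e u)^-1 * gen e v * gen e u) /\
  (forall v, v \notin Y -> f (gen e v) = gen e v).
Proof.
have uY : u \notin Y.
  by apply/negP => /component_off_star_notin; rewrite setU11.
have C1 b : b \in lk e u -> commute (gen e u) (gen e b).
  by rewrite inE; apply: gen_commute.
have C2 b : b \in lk e u -> commute (gen e u)^-1 (gen e b).
  by move/C1/commute_sym/commuteV/commute_sym.
pose F z := raag_lift (pconj_val z).
have FM z : (forall b, b \in lk e u -> commute z (gen e b)) ->
    {morph F z : x y / x * y}.
  by move/pconj_valC/raag_liftM.
have FE z v : (forall b, b \in lk e u -> commute z (gen e b)) ->
    F z (gen e v) = pconj_val z v.
  by move/pconj_valC => zC; rewrite /F raag_lift_gen.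
(* The condition that [F z^-1] fixes [z] holds for [gen e u] and for its inverse, because [u] lies
   outside [Y]. *)
have FK z : (forall b, b \in lk e u -> commute z (gen e b)) ->
    (forall b, b \in lk e u -> commute z^-1 (gen e b)) ->
    F z^-1 z = z -> cancel (F z) (F z^-1).
  move=> zC zVC zE; apply: raag_morph_eq => [x y|//|v]; first by rewrite !FM.
  rewrite FE // /pconj_val; case: ifP => vY; last first.
    by rewrite FE // /pconj_val vY.
  rewrite !FM // (morph_inv (FM _ zVC)) zE FE // /pconj_val vY invgK.
  by rewrite !mulgA mulVg mul1g mulgVK.
have Fu z : (forall b, b \in lk e u -> commute z (gen e b)) ->
    F z (gen e u) = gen e u.
  by move=> zC; rewrite FE // /pconj_val (negbTE uY).
have aF : is_aut (F (gen e u)).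
  apply/asboolP; split; first exact: FM.
  exists (F (gen e u)^-1); first by apply: FK => //; apply: Fu.
  have := FK (gen e u)^-1; rewrite invgK; apply => //.
  by rewrite (morph_inv (FM _ C1)) Fu.
exists (MkAut aF); split=> v vY /=; rewrite FE // /pconj_val ?vY //.
by rewrite (negbTE vY).
Qed.

End PartialConjugation.
End RaagMorphisms.

(** * Ranks of abelian groups spanned by a finite family *)

Section Rank.
Local Open Scope ring_scope.

(** In a Smith normal form [L *m D *m R] of a matrix with more rows than columns, the last row of
    [D] vanishes, so the last row of the inverse of [L] is a solution. *)
Lemma int_row_kernel (m n : nat) (M : 'M[int]_(m, n)) :
  (n < m)%N -> exists2 u : 'rV[int]_m, u != 0 & u *m M = 0.
Proof.
case: m M => [//|m] M; rewrite ltnS => nm.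
have [L Lu [R _ [d _ ->]]] := int_Smith_normal_form M.
exists (delta_mx 0 ord_max *m invmx L).
  apply: contraTneq isT => /(congr1 (mulmx^~ L)); rewrite mulmxKV // mul0mx.
  by move/matrixP => /(_ 0 ord_max); rewrite !mxE !eqxx => /eqP;
    rewrite oner_eq0.
rewrite -!mulmxA mulKmx // mulmxA -rowE.
set D := row _ _; suff -> : D = 0 by rewrite mul0mx.
apply/rowP => j; rewrite !mxE /=.
by rewrite gtn_eqF ?mulr0n // (leq_trans (ltn_ord j)).
Qed.

(** With more than [#|C|] elements, the matrix of their coefficients has a nonzero integer row in
    its left kernel, which is a relation among them. *)
Lemma zfree_leq_span (A : zmodType) (C : finType) (g : C -> A) :
  (forall a, exists k : C -> int, a = \sum_c g c *~ k c) ->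
  forall n (a : 'I_n -> A), zfree a -> (n <= #|C|)%N.
Proof.
move=> spanA n a freea; rewrite leqNgt; apply/negP => ltn.
have [k ak] := boolp.choice (fun i => spanA (a i)).
pose M := \matrix_(i < n, j < #|C|) k i (enum_val j).
have [u u0 uM] := int_row_kernel M ltn.
case/eqP: u0; apply/rowP => i; rewrite mxE; apply: freea i.
under eq_bigr => i _ do rewrite ak mulrz_suml.
rewrite exchange_big big1 //= => c _.
under eq_bigr => i _ do rewrite -mulrzA.
rewrite -mulrz_sumr.
have := congr1 (fun B : 'rV_ _ => B 0 (enum_rank c)) uM; rewrite !mxE.
under eq_bigr => i _ do rewrite mxE enum_rankK mulrC.
by move->; rewrite mulr0z.
Qed.

(** The bound [N] rules out the default value 0 of [zrank]: a largest size of independent families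
    exists and is the rank. *)
Lemma zfree_leq_zrank (A : zmodType) (N : nat) :
  (forall n (a : 'I_n -> A), zfree a -> (n <= N)%N) ->
  forall n (a : 'I_n -> A), zfree a -> (n <= zrank A)%N.
Proof.
move=> ub n a fa; pose P k := `[< exists b : 'I_k -> A, zfree b >].
have exP : exists k, P k by exists n; apply/asboolP; exists a.
have ubP k : P k -> (k <= N)%N by case/asboolP => b /ub.
case: (ex_maxnP exP ubP) => r /asboolP [b fb] maxr.
have -> : zrank A = r.
  apply: zrankE; split; first by exists b.
  by move=> k c fc; apply/maxr/asboolP; exists c.
by apply/maxr/asboolP; exists a.
Qed.

Lemma gen_group_ab_span (G : groupType) (S : G -> Prop) (C : finType)
    (F : C -> G) :
  (forall x, S x -> exists c, x = F c) ->
  exists g : C -> abelianization (gen_group S),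
    forall a, exists k : C -> int, a = \sum_c g c *~ k c.
Proof.
(* If [F c] is outside the subgroup, [insubd] replaces it by 1. *)
move=> SF; pose g c := to_ab (insubd (1%g : gen_group S) (F c)).
exists g => a; rewrite -(to_ab_repr a); move: (repr a) => x {a}.
have gx : generated S (val x) by apply/asboolP/(valP x).
(* The induction on [generated] runs in [G]; intermediate elements are lifted back to the subgroup
   by their own generation proofs. *)
move: {-2}(val x) gx (erefl (val x)) => y gy; elim: gy x => {y}.
- move=> y Sy x yx; have [c yc] := SF y Sy; exists (fun c' => (c' == c)%:Z).
  rewrite (bigD1 c) //= eqxx mulr1z big1 ?addr0 => [|c' /negbTE ->].
    by rewrite /g -yc -yx valKd.
  by rewrite mulr0z.
- move=> x x1; exists (fun=> 0); rewrite big1 => [|c _]; last by rewrite mulr0z.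
  have -> : x = 1%g by apply/val_inj; rewrite x1.
  by [].
- move=> y z gy IHy gz IHz x yzx.
  pose sy : gen_group S := Sub y (asboolT gy).
  pose sz : gen_group S := Sub z (asboolT gz).
  have -> : x = (sy * sz)%g by apply/val_inj; rewrite yzx.
  rewrite to_abM -[ab_add _ _]/(to_ab sy + to_ab sz).
  have [ky ->] := IHy sy (SubK _ _).
  have [kz ->] := IHz sz (SubK _ _).
  exists (fun c => ky c + kz c); rewrite -big_split /=.
  by apply: eq_bigr => c _; rewrite mulrzDr.
- move=> y gy IHy x yx.
  pose sy : gen_group S := Sub y (asboolT gy).
  have -> : x = (sy^-1)%g by apply/val_inj; rewrite yx.
  have [ky kyE] := IHy sy (SubK _ _).
  exists (fun c => - ky c); rewrite to_abV kyE.
  rewrite -[ab_opp _]/(- \sum_c g c *~ ky c) -sumrN.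
  by apply: eq_bigr => c _; rewrite mulrNz.
Qed.

End Rank.

(** * Domination, deep nodes and components of star complements in trees *)

Section Trees.
Variables (V : finType) (e : rel V).
Hypothesis tree_e : is_tree e.

Let e_sym := tree_sym tree_e.
Let e_irr := tree_irr tree_e.

Lemma edge_neq (a b : V) : e a b -> a != b.
Proof. by apply: contraTneq => ->; rewrite e_irr. Qed.

Lemma no_triangle (a b c : V) : e a b -> e b c -> ~~ e c a.
Proof.
move=> ab bc; apply/negP => ca.
suff /(tree_acyclic tree_e) : ucycle e [:: a; b; c] by [].
rewrite /ucycle /= ab bc ca !inE negb_or (edge_neq ab) (edge_neq bc).
by rewrite eq_sym (edge_neq ca).
Qed.

(** Two neighbors [a] and [b] of [u] lie in the star of [w]. If [w] is not [u], they close a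
    triangle when one of them is [w], and the 4-cycle [u], [a], [w], [b] otherwise. *)
Lemma dom_le_eq (u w : V) : 1 < deg e u -> dom_le e u w -> w = u.
Proof.
move=> /card_gt1P [a [b]]; rewrite !inE => -[ua ub ab] /subsetP uw.
apply/eqP; apply: contraT => wu.
have := uw a; have := uw b; rewrite !inE ua ub => /(_ isT) wb /(_ isT) wa.
case/predU1P: wa => [aw|wa].
  case/predU1P: wb => [bw|wb]; first by rewrite aw bw eqxx in ab.
  have := no_triangle ub; rewrite e_sym in wb => /(_ _ wb).
  by rewrite -aw e_sym ua.
case/predU1P: wb => [bw|wb].
  have := no_triangle ua; rewrite e_sym in wa => /(_ _ wa).
  by rewrite -bw e_sym ub.
suff /(tree_acyclic tree_e) : ucycle e [:: u; a; w; b] by [].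
have aw := edge_neq wa; have bw := edge_neq wb.
have au := edge_neq ua; have bu := edge_neq ub.
rewrite /ucycle /= ua wb [e a w]e_sym wa [e b u]e_sym ub !inE !negb_or.
by rewrite au bu ab bw [u == w]eq_sym wu [a == w]eq_sym aw.
Qed.

Lemma dist_le (p : seq V) (x : V) : path e x p -> dist e x (last x p) <= size p.
Proof.
(* [find] returns at most the length of the list, so [dist] is at most [#|V|] and long walks satisfy
   the bound. *)
move=> pth; have [le|lt] := leqP #|V| (size p).
  by rewrite (leq_trans (find_size _ _)) // size_iota.
rewrite leqNgt; apply/negP => /(before_find 0).
rewrite nth_iota // add0n => /negbT/negP; apply; rewrite /walk_of_length.
by apply/existsP; exists (in_tuple p); rewrite pth eqxx.
Qed.

Lemma deep_path (v : V) (p : seq V) :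
  deep e v -> path e v p -> leaf e (last v p) -> 2 < size p.
Proof.
by move=> /forallP /(_ (last v p)) /implyP dv /dist_le pp /dv/leq_trans; apply.
Qed.

(** A node [u] dominated by another node [v] is a leaf, and its neighbor lies in the star of [v]. So
    [u] would be a leaf at distance at most 2 from the deep node [v]. *)
Lemma deep_dom_le (u v : V) : deep e v -> u != v -> ~~ dom_le e u v.
Proof.
move=> dv uv; apply/negP => le_uv.
(* The first step of a path from [u] to [v] shows that [u] is not isolated. *)
have [w uw] : exists w, e u w.
  case/connectP: (tree_connected tree_e u v) => [[|w p]] /=.
    by move=> _ vu; rewrite vu eqxx in uv.
  by case/andP=> uw _ _; exists w.
have leaf_u : leaf e u.
  rewrite /leaf eqn_leq; apply/andP; split; last first.
    by apply/card_gt0P; exists w; rewrite inE.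
  rewrite leqNgt; apply/negP => /dom_le_eq /(_ le_uv) vu.
  by rewrite vu eqxx in uv.
have /subsetP/(_ w) := le_uv; rewrite !inE => /(_ uw) /predU1P [wv|vw].
  have := @deep_path v [:: u] dv.
  by rewrite /= -wv [e w u]e_sym uw => /(_ isT leaf_u).
have := @deep_path v [:: w; u] dv.
by rewrite /= vw [e w u]e_sym uw => /(_ isT leaf_u).
Qed.

Lemma deep_deg (v w x : V) : deep e v -> e v w -> e w x -> 1 < deg e x.
Proof.
move=> dv vw wx; rewrite ltn_neqAle; apply/andP; split.
  rewrite eq_sym; apply/negP => lx.
  by have := @deep_path v [:: w; x] dv; rewrite /= vw wx => /(_ isT lx).
by apply/card_gt0P; exists w; rewrite inE e_sym.
Qed.

Lemma notin_st (v w x : V) : e v w -> e w x -> x != v -> x \notin st e v.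
Proof.
move=> vw wx xv; rewrite !inE negb_or xv /= e_sym; exact: no_triangle wx.
Qed.

(** A simple path from [x] to [x'] off the star of [v] closes up to a cycle: through [w'], [v] and
    [w] if [w] and [w'] differ, and through [w] alone if they agree while [x] and [x'] differ. *)
Lemma connect_off_star_inj (v w x w' x' : V) :
  e v w -> e w x -> x != v -> e v w' -> e w' x' ->
  connect (off_star e v) x x' -> w = w' /\ x = x'.
Proof.
move=> vw wx xv vw' /[swap] /connectP [q qpth ->{x'}] wx'.
case/shortenP: qpth wx' => p pth uniq_p _ wx' {q}.
have out y : y \in x :: p -> y \notin st e v.
  rewrite inE => /predU1P [->|]; first exact: notin_st wx xv.
  elim: p x pth {wx xv uniq_p wx'} => [//|z p IH] x /= /andP [/and3P [_ zv _]].
  by move=> pth; rewrite inE => /predU1P [->//|]; apply: IH pth.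
have {}pth : path e x p by apply: sub_path pth => y z /and3P [].
have vp : v \notin x :: p by apply/negP => /out; rewrite setU11.
have wp z : e v z -> z \notin x :: p.
  by move=> vz; apply/negP => /out; rewrite !inE vz orbT.
have [ww'|ww'] := eqVneq w w'; last first.
  suff /(tree_acyclic tree_e) : ucycle e (v :: w :: x :: rcons p w').
    by rewrite /= size_rcons.
  have perm_c : perm_eq [:: v, w, w', x & p] (v :: w :: x :: rcons p w').
    by rewrite !perm_cons -rcons_cons perm_sym perm_rcons.
  rewrite /ucycle -(perm_uniq perm_c).
  rewrite [cycle _ _]/= !rcons_path last_rcons pth vw wx.
  rewrite [e (last _ _) _]e_sym wx' [e w' v]e_sym vw' //.
  rewrite cons_uniq 2!in_cons 2!negb_or (edge_neq vw) (edge_neq vw') vp.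
  rewrite cons_uniq in_cons negb_or ww' wp //.
  by rewrite cons_uniq wp.
split=> //; case: p pth wx' wp uniq_p {out vp} => [//|y p] pth wx' wp uniq_p.
suff /(tree_acyclic tree_e) : ucycle e [:: w, x, y & p] by [].
rewrite /ucycle; apply/andP; split; last by rewrite cons_uniq wp.
suff : path e w (rcons (x :: y :: p) w) by [].
by rewrite rcons_path /= wx; move: pth wx' => /= ->; rewrite -ww' e_sym.
Qed.

(** The factor [deg w - 1] counts the neighbors of [w] other than [v]. *)
Lemma Upsilon_card :
  Upsilon e = #|[set t : V * V * V | [&& deep e t.1.1, e t.1.1 t.1.2,
                                       e t.1.2 t.2 & t.2 != t.1.1]]|.
Proof.
rewrite -sum1_card /Upsilon.
transitivity (\sum_(v | deep e v) \sum_(w in lk e v) \sum_(x in lk e w :\ v) 1).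
  apply: eq_bigr => v _; apply: eq_bigr => w; rewrite inE => vw.
  by rewrite sum1_card /deg (cardsD1 v (lk e w)) inE e_sym vw addKn.
rewrite pair_big_dep pair_big_dep /=; apply: eq_bigl => -[[v w] x] /=.
by rewrite !inE /= -andbA [_ && (x != v)]andbC.
Qed.

End Trees.

(** * A finite spanning family of the abelianization *)

Section GeneratorCodes.
Local Open Scope group_scope.
Variables (V : finType) (e : rel V).

(** Codes form a finite type large enough for all generators of [AutStar]; a code may belong to no
    automorphism. *)
Definition has_code (c : V * V + V * {set V} + V) (f : Aut (raag e)) : Prop :=
  match c with
  | inl (inl (u, v)) => f (gen e u) = gen e u * gen e v /\
      forall w, w != u -> f (gen e w) = gen e w
  | inl (inr (u, Y)) =>
      (forall v, v \in Y -> f (gen e v) = (gen e u)^-1 * gen e v * gen e u) /\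
      (forall v, v \notin Y -> f (gen e v) = gen e v)
  | inr v => f (gen e v) = (gen e v)^-1 /\
      forall w, w != v -> f (gen e w) = gen e w
  end.

Lemma has_code_inj c (f g : Aut (raag e)) :
  has_code c f -> has_code c g -> f = g.
Proof.
move=> cf cg; apply: aut_eq_gen => w.
case: c cf cg => [[[u v]|[u Y]]|v] /= [f1 f2] [g1 g2].
- by have [->|wu] := eqVneq w u; [rewrite f1 g1|rewrite f2 ?g2].
- by case: (boolP (w \in Y)) => wY; [rewrite f1 ?g1|rewrite f2 ?g2].
- by have [->|wu] := eqVneq w v; [rewrite f1 g1|rewrite f2 ?g2].
Qed.

(** Finite spanning bounds the size of independent families, so that [b1] is a genuine rank rather
    than its default value. *)
Lemma AutStar_ab_span :
  exists (C : finType) (g : C -> abelianization (AutStar e)),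
    forall a, exists k : C -> int, a = (\sum_c g c *~ k c)%R.
Proof.
pose F c := if pselect (exists f, has_code c f) is left ex then sval (cid ex)
            else 1.
have FE c f : has_code c f -> f = F c.
  move=> cf; rewrite /F; case: pselect => [ex|[]]; last by exists f.
  exact: has_code_inj cf (svalP (cid ex)).
exists (V * V + V * {set V} + V)%type; apply: (@gen_group_ab_span _ _ _ F).
move=> f [[u [v [_ _ f1 f2]]]|[u [Y [_ f1 f2]]]|[v [_ f1 f2]]].
- by exists (inl (inl (u, v))); apply: FE.
- by exists (inl (inr (u, Y))); apply: FE.
- by exists (inr v); apply: FE.
Qed.

End GeneratorCodes.

(** * The exponent of [v] in the conjugator of [x], as a homomorphism to the integers *)

Section ConjugatorExponent.
Local Open Scope group_scope.
Variables (V : finType) (e : rel V).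
Variables (v x : V).
Hypotheses (e_sym : symmetric e) (xv : x \notin st e v).
Hypothesis v_min : forall u, u != v -> ~~ dom_le e u v.
Hypothesis x_max : forall w, dom_le e x w -> w = x.

Definition heis_val (w : V) : heis :=
  if w == x then heis_x else if w == v then heis_y else 1.

Definition rho : raag e -> heis := raag_lift heis_val.

(** The only values that fail to commute are those of [x] and [v], and these nodes are not
    adjacent. *)
Lemma heis_valC a b : e a b -> commute (heis_val a) (heis_val b).
Proof.
move: xv; rewrite !inE negb_or => /andP [_ evx].
rewrite /heis_val.
case: (eqVneq a x) => [->|ax]; case: (eqVneq b x) => [->|bx] //.
- case: eqVneq => [->|_ _]; last exact: commute1.
  by rewrite e_sym (negbTE evx).
- case: eqVneq => [->|_ _]; last exact/commute_sym/commute1.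
  by rewrite (negbTE evx).
move=> _; case: eqVneq => _; last exact/commute_sym/commute1.
by case: eqVneq => _ //; apply: commute1.
Qed.

Let rhoM : {morph rho : y z / y * z} := raag_liftM heis_valC.

Lemma rho_gen w : rho (gen e w) = heis_val w.
Proof. exact: raag_lift_gen heis_valC w. Qed.

Definition v_exp (y : raag e) : int := (rho y).1.2.

Lemma v_expM y z : v_exp (y * z) = (v_exp y + v_exp z)%R.
Proof. by rewrite /v_exp rhoM. Qed.

Lemma v_expV y : v_exp y^-1 = (- v_exp y)%R.
Proof. by rewrite /v_exp morph_inv. Qed.

Lemma v_exp_gen w : v_exp (gen e w) = (w == v)%:Z%R.
Proof.
rewrite /v_exp rho_gen /heis_val; case: eqVneq => [->|_]; last by case: eqVneq.
by case: eqVneq => // xE; move: xv; rewrite xE setU11.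
Qed.

Lemma rho_conj g : rho (g * gen e x * g^-1) = (1, 0, - v_exp g)%R.
Proof.
by rewrite !rhoM morph_inv // rho_gen /heis_val eqxx heis_conj_x.
Qed.

(** The first clause makes the conjugator exponent additive: if [h] conjugates [x] by [b] and [f] by
    [a], then their product conjugates it by [f b * a], where [f b] has the same [v]-exponent as
    [b]. *)
Definition tame (f : Aut (raag e)) : Prop :=
  (forall y, v_exp (f y) = v_exp y) /\
  exists g, f (gen e x) = g * gen e x * g^-1.

Lemma v_exp_preserved (f : Aut (raag e)) :
  (forall w, v_exp (f (gen e w)) = v_exp (gen e w)) ->
  forall y, v_exp (f y) = v_exp y.
Proof.
have fM := autM f; move=> fgen y.
elim: (raag_generated y) => {y} [_ [w ->]||y z _ IHy _ IHz|y _ IHy] //.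
- by rewrite morph_one.
- by rewrite fM !v_expM IHy IHz.
- by rewrite morph_inv // !v_expV IHy.
Qed.

(** Thinness of [v], and of [x] below, ensures that no thin inversion inverts them. *)
Lemma v_thin : thin e v.
Proof.
apply/cards1P; exists v; apply/setP => w; rewrite !inE /dom_eq.
have [->|wv] := eqVneq w v; last by rewrite (negbTE (v_min wv)) andbF.
by rewrite andbb; apply/fintype.subsetP => y; rewrite !inE => ->; rewrite orbT.
Qed.

Lemma x_thin : thin e x.
Proof.
apply/cards1P; exists x; apply/setP => w; rewrite !inE /dom_eq.
have [->|wx] := eqVneq w x; last first.
  by apply/negbTE; apply: contra wx => /andP [/x_max ->].
by rewrite andbb; apply/fintype.subsetP => y; rewrite !inE => ->; rewrite orbT.
Qed.

Lemma AutStar_tame (f : AutStar e) : tame (val f).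
Proof.
move/asboolP: (valP f); move: (val f) => {}f; elim=> {f} [f||f h|f].
- case=> [[u [w [uw le_uw f1 f2]]]|[u [Y [_ f1 f2]]]|[w [nthin f1 f2]]].
  (* By minimality of [v] the multiplier is not [v], and by maximality of [x] the transvected
     generator is not [x]. *)
  + split.
      apply: v_exp_preserved => a; have [->|au] := eqVneq a u; last first.
        by rewrite f2.
      rewrite f1 v_expM [v_exp (gen e w)]v_exp_gen; case: eqVneq => [wv|_].
        by rewrite wv in uw le_uw; rewrite (negbTE (v_min uw)) in le_uw.
      by rewrite addr0.
    exists 1; rewrite f2 ?mul1g ?invg1 ?mulg1 //.
    apply: contraNneq uw => xu; rewrite -xu in le_uw *.
    by rewrite (x_max le_uw).
  + split.
      apply: v_exp_preserved => a; case: (boolP (a \in Y)) => aY; last first.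
        by rewrite f2.
      by rewrite f1 // !v_expM v_expV addrAC addNr add0r.
    case: (boolP (x \in Y)) => xY.
      by exists (gen e u)^-1; rewrite f1 // invgK.
    by exists 1; rewrite f2 // mul1g invg1 mulg1.
  + split.
      apply: v_exp_preserved => a; have [->|aw] := eqVneq a w; last first.
        by rewrite f2.
      rewrite f1 v_expV !v_exp_gen; case: eqVneq => [wv|_] //.
      by rewrite wv v_thin in nthin.
    exists 1; rewrite f2 ?mul1g ?invg1 ?mulg1 //.
    by apply: contraNneq nthin => <-; apply: x_thin.
- by split=> //; exists 1; rewrite mul1g invg1 mulg1.
- move=> _ [fv [a fa]] _ [hv [b hb]]; split=> [y|].
    by rewrite -[v_exp y]hv -[RHS]fv.
  exists (f b * a); rewrite -[LHS]/(f (h (gen e x))) hb.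
  have fM := autM f.
  by rewrite !fM morph_inv // fa invgM !mulgA.
- move=> _ [fv [a fa]]; have fK y : f (f^-1 y) = y by apply: aut_funK.
  have Kf y : f^-1 (f y) = y by apply: aut_inv_funK.
  split=> [y|]; first by rewrite -fv fK.
  have fM := autM f^-1.
  (* Apply [f^-1] to [f x = a x a^-1] and solve for the image of [x] under [f^-1]. *)
  exists (f^-1 a)^-1; rewrite invgK.
  rewrite -{2}[gen e x]Kf fa !fM (morph_inv fM).
  by rewrite !mulgA mulVg mul1g mulgVK.
Qed.

(** This is minus the exponent of [v] in [g] when [f] sends [x] to [g x g^-1]. With this sign, the
    partial conjugation by [v] of the component of [x] has value 1. *)
Definition conj_exp (f : AutStar e) : int := (rho (val f (gen e x))).2.

Lemma conj_expM f h : conj_exp (f * h) = (conj_exp f + conj_exp h)%R.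
Proof.
have [fv [a fa]] := AutStar_tame f; have [_ [b hb]] := AutStar_tame h.
have fM := autM (val f).
rewrite /conj_exp -[val (f * h) _]/(val f (val h (gen e x))) hb fa.
rewrite !fM morph_inv // fa.
have -> : val f b * (a * gen e x * a^-1) * (val f b)^-1 =
  (val f b * a) * gen e x * (val f b * a)^-1 by rewrite invgM !mulgA.
by rewrite !rho_conj /= v_expM fv; ring.
Qed.

Lemma conj_exp_pconj (f : AutStar e) (u : V) (Y : {set V}) :
  (forall w, w \in Y -> val f (gen e w) = (gen e u)^-1 * gen e w * gen e u) ->
  (forall w, w \notin Y -> val f (gen e w) = gen e w) ->
  conj_exp f = ((u == v) && (x \in Y))%:Z%R.
Proof.
move=> f1 f2; rewrite /conj_exp; case: (boolP (x \in Y)) => xY.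
  rewrite f1 // andbT -{2}[gen e u]invgK rho_conj /= v_expV opprK.
  exact: v_exp_gen.
by rewrite f2 // andbF rho_gen /heis_val eqxx.
Qed.

End ConjugatorExponent.

(** * Dual families and the lower bound for the Betti number *)

Lemma zfree_dual (A : zmodType) (n : nat) (a : 'I_n -> A)
    (h : 'I_n -> {additive A -> int}) :
  (forall i j, h i (a j) = (i == j)%:Z%R) -> zfree a.
Proof.
move=> ha c sum0 i; have := congr1 (h i) sum0.
rewrite raddf0 raddf_sum (bigD1 i) //= raddfMz ha eqxx big1 ?addr0.
  by rewrite mulrzz mul1r.
by move=> j ji; rewrite raddfMz ha eq_sym (negbTE ji) mul0rz.
Qed.

Theorem theorem1 (V : finType) (e : rel V) (tree_e : is_tree e) :
  (Upsilon e <= b1 (AutStar e))%N.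
Proof.
have e_sym := tree_sym tree_e.
have [C [g gspan]] := AutStar_ab_span e.
rewrite (Upsilon_card tree_e); set T := [set _ | _].
pose Y (t : V * V * V) := [set y | connect (off_star e t.1.1) t.2 y].
have T_out t : t \in T -> t.2 \notin st e t.1.1.
  by rewrite inE => /and4P [_ vw wx xv]; apply: notin_st vw wx xv.
have T_min t : t \in T -> forall u, u != t.1.1 -> ~~ dom_le e u t.1.1.
  by rewrite inE => /and4P [dv _ _ _] u; apply: deep_dom_le.
have T_max t : t \in T -> forall w, dom_le e t.2 w -> w = t.2.
  rewrite inE => /and4P [dv vw wx _] w; apply: dom_le_eq => //.
  exact: deep_deg dv vw wx.
have pc t : t \in T -> exists f : AutStar e,
    (forall w, w \in Y t -> val f (gen e w) =
       (gen e t.1.1)^-1 * gen e w * gen e t.1.1)%g /\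
    (forall w, w \notin Y t -> val f (gen e w) = gen e w).
  move=> tT; have compY : component_off_star e t.1.1 (Y t).
    by exists t.2; first exact: T_out.
  have [f [f1 f2]] := pconj_exists e_sym compY.
  have Sf : generatedb (fun f : Aut (raag e) => [\/ is_transvection f,
      is_partial_conjugation f | is_thin_inversion f]) f.
    by apply/asboolP/Gen_in/Or32; exists t.1.1, (Y t).
  by exists (Sub f Sf).
pose t (i : 'I_#|T|) := enum_val i; have tT i : t i \in T := enum_valP i.
pose c i := sval (cid (pc _ (tT i))).
have c1 i := (svalP (cid (pc _ (tT i)))).1.
have c2 i := (svalP (cid (pc _ (tT i)))).2.
have hM i := conj_expM e_sym (T_out _ (tT i)) (T_min _ (tT i)) (T_max _ (tT i)).
pose h i := sval (to_ab_lift (hM i)).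
have hE i y : h i (to_ab y) = conj_exp (t i).1.1 (t i).2 y.
  exact: svalP (to_ab_lift (hM i)) y.
apply: (zfree_leq_zrank (zfree_leq_span gspan) (a := fun i => to_ab (c i))).
apply: (@zfree_dual _ _ _ h) => i j; rewrite hE.
rewrite (conj_exp_pconj e_sym (T_out _ (tT i)) (c1 j) (c2 j)).
congr (Posz (nat_of_bool _)).
(* The value is 1 exactly when both triples have the same [v] and their last nodes lie in one
   component off its star; the absence of cycles then makes the triples equal. *)
apply/andP/eqP => [[/eqP vv]|<-]; last by rewrite eqxx inE connect0.
rewrite inE => xx; apply: enum_val_inj; rewrite -/(t i) -/(t j).
move: (tT i) (tT j) vv xx; case: (t i) (t j) => [[v w] x] [[v' w'] x'] /=.
rewrite !inE /= => /and4P [_ vw wx xv] /and4P [_ vw' wx' xv'] vv.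
rewrite {}vv in vw' xv' *.
by case/(connect_off_star_inj tree_e vw' wx' xv' vw wx) => -> ->.
Qed.
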